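(* Let $p$ be an odd prime and let $n\ge 0$ be an integer. (1) If $(p-1)\nmid n$, then $\mathbf G_n(p)\equiv 0\pmod p$ in $\mathbb Z[i]$. (2) If $n=r(p-1)$ with $1\le r<p$, then $\mathbf G_n(p)\equiv 1+i^{\,r(p-1)}\pmod p$ in $\mathbb Z[i]$. In particular, $\mathbf G_{p-1}(p)\equiv 0\pmod p$ if $p\equiv 3\pmod 4$, and $\mathbf G_{p-1}(p)\equiv 2\pmod p$ if $p\equiv 1\pmod 4$.
   Context: Here $i^2=-1$, and for an odd prime $p$ and integer $n\ge 0$, $\mathbf G_n(p)=\sum_{a=1}^{p-1}\sum_{b=1}^{p-1}(a+bi)^n\in\mathbb Z[i]$. *)

(* Defs.v *)
From HB Require Import structures.
From mathcomp Require Import all_boot all_order all_algebra all_field.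

Set Implicit Arguments.
Unset Strict Implicit.
Unset Printing Implicit Defensive.

Import Order.TTheory GRing.Theory Num.Theory.

Local Open Scope ring_scope.

(* The ring Z[i], realised as the subring of the algebraic numbers whose real
   and imaginary parts are both rational integers. *)
Definition gaussInt_pred : pred algC :=
  fun x => ('Re x \in Num.int) && ('Im x \in Num.int).
Arguments gaussInt_pred _ /.
Definition gaussInt : qualifier 1 algC := [qualify a x | gaussInt_pred x].

Lemma gaussInt_subring_closed : subring_closed gaussInt.
Proof.
split=> [|x y /andP[xr xi] /andP[yr yi]|x y /andP[xr xi] /andP[yr yi]].
- by rewrite qualifE/= (Creal_ReP _ _) ?(Creal_ImP _ _) ?rpred1 ?rpred0.
- by rewrite qualifE/= !raddfB/= !rpredB.
- by rewrite qualifE/= ReM ImM !(rpredB, rpredD, rpredM).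
Qed.

HB.instance Definition _ := GRing.isSubringClosed.Build algC
  gaussInt_pred gaussInt_subring_closed.

Record Zi := MkZi { algZi :> algC; algZiP : algZi \is a gaussInt }.

HB.instance Definition _ := [isSub for algZi].
HB.instance Definition _ := [Choice of Zi by <:].
HB.instance Definition _ := [SubChoice_isSubComNzRing of Zi by <:].

Lemma gaussInt_i : ('i : algC) \is a gaussInt.
Proof. by rewrite qualifE/= Re_i Im_i rpred0 rpred1. Qed.

Definition iZi : Zi := MkZi gaussInt_i.

Lemma gaussIntP (x : algC) :
  reflect (exists a b : int, x = a%:~R + 'i * b%:~R) (x \is a gaussInt).
Proof.
apply: (iffP andP) => [[/intrP[a xr] /intrP[b xi]]|[a [b ->]]].
  by exists a, b; rewrite -xr -xi -Crect.
by rewrite Re_rect ?Im_rect ?intr_int ?realz.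
Qed.

Lemma sqr_iZi : iZi ^+ 2 = -1.
Proof. by apply: val_inj; rewrite /= -expr2 sqrCi. Qed.

Definition Zi_cong (p : nat) (x y : Zi) : Prop :=
  exists w : Zi, x - y = p%:R * w.

Definition G (n p : nat) : Zi :=
  \sum_(1 <= a < p) \sum_(1 <= b < p) (a%:R + b%:R * iZi) ^+ n.

(* Main.v *)
Require Import Defs.
From mathcomp Require Import all_boot all_order all_algebra all_field.
From mathcomp Require Import all_fingroup all_solvable.

Import GRing.Theory FinRing.Theory.

Local Open Scope ring_scope.

(** The sum [G n p] is the value at i of an integer polynomial, the sum of
    the [(a + b X)^n]. If that polynomial agrees modulo p with another integer
    polynomial, then their values at i are congruent modulo p. So the work
    takes place in F[X], with F the field with p elements, where
    [S = \sum_(a, b != 0) (a + b X)^n] has to be computed; the relation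
    i^2 = -1 enters only in the two particular cases.

    Substituting [a = b t] factors S as
    [(\sum_(b != 0) b^n) * \sum_(t != 0) (t + X)^n]. The first factor is 0
    when p - 1 does not divide n, and -1 when it does: this is (1), and leaves
    the second factor to compute for n = r (p - 1).

    Since r (p - 1) = p (r - 1) + (p - r), and t^p = t in F, Frobenius gives
      [(t + X)^n = (t + X^p)^(r-1) * (t + X)^(p-r)],
    which is the value at t of a monic polynomial Q of degree only p - 1 over
    F[X]. Summed over all of F, the powers of t of exponent less than p - 1
    give 0 and t^(p-1) gives -1, so the values of Q sum to -1. Removing the
    term [Q(0) = X^n] yields -1 - X^n, whence S = 1 + X^n, which is (2).
    The computation is the same over any finite field, with its number q of
    elements in place of p. *)

(** * Power sums over a finite field *)

Lemma pnat_card_finField (F : finFieldType) : [pchar F].-nat #|F|.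
Proof.
have [p p_pr pF] := finPcharP F.
have := abelem_pgroup (fin_ring_pchar_abelem pF).
by rewrite /pgroup cardsT (eq_pnat _ (pcharf_eq pF)).
Qed.

(** Translation by 1 permutes F, so it fixes the sum of all elements of F;
    but it also adds 1 to each of the q terms. *)
Lemma natr_card_finField (F : finFieldType) : #|F|%:R = 0 :> F.
Proof.
apply: (addrI (\sum_(x : F) x)); rewrite addr0 [RHS](reindex_inj (addIr 1)) /=.
by rewrite big_split sumr_const.
Qed.

Lemma expf_neq1_finField (F : finFieldType) (n : nat) :
  ~~ (#|F|.-1 %| n)%N -> exists2 g : F, g != 0 & g ^+ n != 1.
Proof.
move=> q'n.
have /cyclicP[u genu] := field_unit_group_cyclic [set: {unit F}]%G.
exists (val u); first by rewrite -unitfE (valP u).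
rewrite -val_unitX -val_unit1 val_eqE -order_dvdn.
by rewrite -card_finField_unit genu in q'n.
Qed.

(** Multiplication by some g with g^n <> 1 permutes the nonzero elements, and
    multiplies the sum by g^n. *)
Lemma sum_exprn_Ndvd (F : finFieldType) (n : nat) :
  ~~ (#|F|.-1 %| n)%N -> \sum_(a : F | a != 0) a ^+ n = 0.
Proof.
move=> /expf_neq1_finField[g g0 gn1]; set S := \sum_(a | _) _.
have: S = g ^+ n * S.
  rewrite {1}/S (reindex_inj (mulfI g0)) /= mulr_sumr.
  by apply: eq_big => [a | a _]; rewrite ?mulf_eq0 ?(negPf g0) // exprMn.
move/eqP; rewrite -subr_eq0 -{1}[S]mul1r -mulrBl mulf_eq0 subr_eq0 eq_sym.
by rewrite (negPf gn1) => /eqP.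
Qed.

Lemma expf_card_pred (F : finFieldType) (a : F) : a != 0 -> a ^+ #|F|.-1 = 1.
Proof.
move=> a0; apply: (mulfI a0); rewrite -exprS prednK ?expf_card ?mulr1 //.
exact: ltnW (finNzRing_gt1 F).
Qed.

Lemma sum_exprn_dvd (F : finFieldType) (n : nat) :
  (#|F|.-1 %| n)%N -> \sum_(a : F | a != 0) a ^+ n = -1.
Proof.
case/dvdnP=> r ->.
rewrite (eq_bigr (fun=> 1)) => [|a a0]; last first.
  by rewrite mulnC exprM expf_card_pred // expr1n.
have : \sum_(a : F) (1 : F) = 0 by rewrite sumr_const natr_card_finField.
by rewrite (bigD1 0) //= addrC => /eqP; rewrite addr_eq0 => /eqP.
Qed.

(** Among the exponents k < q, only k = q - 1 has a nonzero power sum over the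
    whole of F. So summing over F a polynomial of degree less than q reads off
    its top coefficient. *)
Lemma sum_horner_finField (F : finFieldType) (Q : {poly {poly F}}) :
  (size Q <= #|F|)%N -> \sum_(t : F) Q.[t%:P] = - Q`_(#|F|.-1).
Proof.
move=> szQ; have q_gt1 := finNzRing_gt1 F.
pose S k : F := \sum_t t ^+ k.
have -> : \sum_(t : F) Q.[t%:P] = \sum_(k < #|F|) Q`_k * (S k)%:P.
  rewrite (eq_bigr _ (fun t _ => horner_coef_wide t%:P szQ)) exchange_big /=.
  apply: eq_bigr => k _; rewrite rmorph_sum mulr_sumr.
  by apply: eq_bigr => t _; rewrite rmorphXn.
have S0 k : (k < #|F|.-1)%N -> S k = 0.
  (* In degree 0 the term t = 0 counts, so the sum is q = 0 and not q - 1. *)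
  case: k => [_|k ltk]; first by rewrite /S sumr_const natr_card_finField.
  rewrite /S (bigD1 0) //= expr0n add0r sum_exprn_Ndvd //.
  by apply/negP => /(dvdn_leq (ltn0Sn k)); rewrite leqNgt ltk.
have Sq : S #|F|.-1 = -1.
  rewrite /S (bigD1 0) //= expr0n -subn1 subn_eq0 leqNgt q_gt1 add0r.
  by rewrite subn1 sum_exprn_dvd.
rewrite -(prednK (ltnW q_gt1)) big_ord_recr big1 /= => [|k _].
  by rewrite add0r Sq rmorphN mulrN mulr1.
by rewrite S0 ?mulr0.
Qed.

(** * Power sums of linear forms *)

(** The form is homogeneous of degree n, so its values are determined by the
    ratio t = a / b: substitute a = b t. *)
Lemma sum_linear_form_exprnE (F : finFieldType) (n : nat) :
  \sum_(a : F | a != 0) \sum_(b : F | b != 0) (a%:P + b%:P * 'X) ^+ n =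
  (\sum_(b : F | b != 0) b ^+ n)%:P * \sum_(t : F | t != 0) (t%:P + 'X) ^+ n.
Proof.
rewrite exchange_big rmorph_sum mulr_suml /=; apply: eq_bigr => b b0.
rewrite (reindex_inj (mulfI b0)) mulr_sumr /=.
apply: eq_big => [t | t _]; first by rewrite mulf_eq0 (negPf b0).
by rewrite rmorphM -mulrDr exprMn rmorphXn.
Qed.

(** The bound r <= q is what makes the Frobenius exponent split possible with
    q - r nonnegative; it lowers the degree in t from r (q - 1) to q - 1, the
    range in which [sum_horner_finField] applies. *)
Lemma sum_shift_exprn (F : finFieldType) (r : nat) (q := #|F|) :
  (1 <= r <= q)%N ->
  \sum_(t : F | t != 0) (t%:P + 'X) ^+ (r * q.-1) = -1 - 'X^(r * q.-1).
Proof.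
move=> /andP[r_gt0 le_rq]; have q_gt0 : (0 < q)%N := ltnW (finNzRing_gt1 F).
have exp_split : (r * q.-1 = q * r.-1 + (q - r))%N.
  by rewrite -!subn1 !mulnBr !muln1 mulnC addnBA // subnK // leq_pmulr.
pose Q : {poly {poly F}} := ('X + ('X^q)%:P) ^+ r.-1 * ('X + 'X%:P) ^+ (q - r).
have QE (t : F) : Q.[t%:P] = (t%:P + 'X) ^+ (r * q.-1).
  rewrite exp_split exprD exprM exprDn_pchar; last first.
    by rewrite (eq_pnat _ (@pchar_poly F)) pnat_card_finField.
  by rewrite -rmorphXn expf_card !hornerE.
have XD_monic (c : {poly F}) : 'X + c%:P \is monic.
  by rewrite -[c]opprK rmorphN monicXsubC.
have XD_size (c : {poly F}) n : size (('X + c%:P) ^+ n) = n.+1.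
  by rewrite -[c]opprK rmorphN size_exp_XsubC.
have Qmonic : Q \is monic by rewrite rpredM ?monic_exp.
have Qsize : size Q = q.
  rewrite size_monicM ?monic_exp -?size_poly_eq0 ?XD_size //= addnS /=.
  by rewrite -addSn prednK // subnKC.
have Qlead : Q`_q.-1 = 1 by rewrite -Qsize; apply: (monicP Qmonic).
have := sum_horner_finField _ Q; rewrite Qsize => /(_ (leqnn _)).
rewrite -/q Qlead (bigD1 0) //= QE.
rewrite rmorph0 add0r (eq_bigr _ (fun t _ => QE t)) => /eqP.
by rewrite addrC eq_sym -subr_eq => /eqP <-.
Qed.

Lemma sum_linear_form_exprn_Ndvd (F : finFieldType) (n : nat) :
  ~~ (#|F|.-1 %| n)%N ->
  \sum_(a : F | a != 0) \sum_(b : F | b != 0) (a%:P + b%:P * 'X) ^+ n = 0.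
Proof.
by move=> q'n; rewrite sum_linear_form_exprnE sum_exprn_Ndvd // rmorph0 mul0r.
Qed.

Lemma sum_linear_form_exprn_dvd (F : finFieldType) (r : nat) :
  (1 <= r <= #|F|)%N ->
  \sum_(a : F | a != 0) \sum_(b : F | b != 0)
     (a%:P + b%:P * 'X) ^+ (r * #|F|.-1) = 1 + 'X^(r * #|F|.-1).
Proof.
move=> r_le; rewrite sum_linear_form_exprnE sum_shift_exprn //.
by rewrite sum_exprn_dvd ?dvdn_mull // rmorphN mulN1r opprB opprK addrC.
Qed.

(** * Reduction modulo p *)

Lemma sum_nat_Fp (V : nmodType) (p : nat) (f : 'F_p -> V) : prime p ->
  \sum_(1 <= a < p) f a%:R = \sum_(a : 'F_p | a != 0) f a.
Proof.
move=> p_pr.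
have -> : index_iota 1 p = index_iota 1 (Zp_trunc (pdiv p)).+2 by rewrite Fp_cast.
rewrite big_add1 big_mkord [RHS]big_mkcond [RHS]big_ord_recl /= [RHS]add0r.
apply: eq_bigr => i _.
by rewrite -[in RHS](natr_Zp (lift ord0 i)).
Qed.

Lemma map_poly_Fp_cong (p : nat) (P Q : {poly int}) : prime p ->
  map_poly (intr : int -> 'F_p) P = map_poly intr Q ->
  exists D : {poly int}, P - Q = p%:R * D.
Proof.
move=> p_pr PQ.
exists (map_poly (fun c : int => (c %/ p)%Z) (P - Q)).
apply/polyP => i; rewrite -polyC_natr coefCM coef_map_id0 ?div0z //.
rewrite natz mulrC divzK // (dvdz_pcharf (pchar_Fp p_pr)).
by rewrite coefB rmorphB subr_eq0 -!coef_map PQ.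
Qed.

(** Replacing i by an indeterminate separates the congruence modulo p from the
    relation i^2 = -1. *)
Definition G_poly (n p : nat) : {poly int} :=
  \sum_(1 <= a < p) \sum_(1 <= b < p) (a%:R + b%:R * 'X) ^+ n.

Lemma horner_G_poly (n p : nat) :
  (map_poly (intr : int -> Zi) (G_poly n p)).[iZi] = G n p.
Proof.
rewrite /G_poly !rmorph_sum horner_sum; apply: eq_bigr => a _.
rewrite !rmorph_sum horner_sum; apply: eq_bigr => b _ /=.
by rewrite rmorphXn rmorphD rmorphM !rmorph_nat /= map_polyX -!polyC_natr
  !(horner_exp, hornerE).
Qed.

Lemma map_G_poly_Fp (n p : nat) : prime p ->
  map_poly (intr : int -> 'F_p) (G_poly n p) =
  \sum_(a : 'F_p | a != 0) \sum_(b : 'F_p | b != 0) (a%:P + b%:P * 'X) ^+ n.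
Proof.
move=> p_pr; rewrite -sum_nat_Fp // rmorph_sum; apply: eq_bigr => a _.
rewrite -sum_nat_Fp // rmorph_sum; apply: eq_bigr => b _.
by rewrite rmorphXn rmorphD rmorphM /= !rmorph_nat map_polyX.
Qed.

(** This carries identities over the prime field to Z[i]: any integer lift of
    the power sum in F_p[X] computes [G n p] modulo p. *)
Lemma Zi_cong_G (n p : nat) (P : {poly int}) : prime p ->
  \sum_(a : 'F_p | a != 0) \sum_(b : 'F_p | b != 0) (a%:P + b%:P * 'X) ^+ n
    = map_poly intr P ->
  Zi_cong p (G n p) (map_poly intr P).[iZi].
Proof.
move=> p_pr; rewrite -map_G_poly_Fp // => /(map_poly_Fp_cong _ _ _ p_pr)[D GD].
exists (map_poly intr D).[iZi].
rewrite -horner_G_poly -hornerN -hornerD -rmorphB GD rmorphM rmorph_nat /=.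
by rewrite -polyC_natr hornerCM.
Qed.

Theorem theorem2 (p : nat) (p_prime : prime p) (p_odd : odd p) :
  (forall n : nat,
      (~~ (p.-1 %| n)%N -> Zi_cong p (G n p) 0) /\
      (forall r : nat, (1 <= r < p)%N -> n = (r * p.-1)%N ->
         Zi_cong p (G n p) (1 + iZi ^+ (r * p.-1)))) /\
  ((p = 3 %[mod 4])%N -> Zi_cong p (G p.-1 p) 0) /\
  ((p = 1 %[mod 4])%N -> Zi_cong p (G p.-1 p) 2).
Proof.
have caseD r : (1 <= r < p)%N ->
    Zi_cong p (G (r * p.-1) p) (1 + iZi ^+ (r * p.-1)).
  case/andP=> r_gt0 /ltnW r_le; set n := (r * p.-1)%N.
  have -> : 1 + iZi ^+ n = (map_poly intr (1 + 'X^n : {poly int})).[iZi].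
    by rewrite rmorphD rmorph1 /= map_polyXn !hornerE.
  apply: Zi_cong_G => //; rewrite rmorphD rmorph1 /= map_polyXn.
  have := sum_linear_form_exprn_dvd 'F_p r.
  by rewrite card_Fp // r_gt0 r_le; apply.
have case1 : Zi_cong p (G p.-1 p) (1 + iZi ^+ p.-1).
  by have := caseD 1; rewrite mul1n prime_gt1 //; apply.
have iZi4 : iZi ^+ 4 = 1 by rewrite (exprM _ 2 2) sqr_iZi sqrrN expr1n.
split=> [n|]; split.
- move=> p'n.
  have -> : 0 = (map_poly intr (0 : {poly int})).[iZi] by rewrite rmorph0 horner0.
  apply: Zi_cong_G => //.
  by rewrite rmorph0 sum_linear_form_exprn_Ndvd // card_Fp.
- by move=> r r_p ->; apply: caseD.
- move=> p3; suff <- : 1 + iZi ^+ p.-1 = 0 by [].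
  rewrite (divn_eq p 4) p3 addnS /= exprD mulnC exprM iZi4 expr1n mul1r.
  by rewrite sqr_iZi subrr.
- move=> p1; suff <- : 1 + iZi ^+ p.-1 = 2 by [].
  by rewrite (divn_eq p 4) p1 addn1 /= mulnC exprM iZi4 expr1n.
Qed.
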